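(* There is a universal constant $C$ such that the following holds. Let $A$ be drawn from the $(m,n,\lambda)$-Poisson ensemble with $n$ even, $\lambda\le \mathrm{poly}(n)$ and $n> C\,m\log m$. Then $\mathrm{disc}(A)=1$ with high probability.
   Context: For $A\in\mathbb{R}^{m\times n}$, the discrepancy is $\mathrm{disc}(A)=\min_{u\in\{-1,+1\}^n}\|Au\|_\infty$. The $(m,n,\lambda)$-Poisson ensemble is the law of an $m\times n$ random matrix with independent, identically distributed Poisson$(\lambda)$ entries. The condition $\lambda\le\mathrm{poly}(n)$ means that $\lambda$ is bounded above by a polynomial in $n$. Asymptotics are as $m\to\infty$ (and therefore $n\to\infty$); ''with high probability'' means with probability $1-o(1)$ in this limit.
   Formalization: The constant C may depend on the polynomial bounding λ (no single C works for all polynomials, by a first-moment bound), and mnλ → ∞ with λ > 0 is assumed, since otherwise A = 0 with non-vanishing probability and disc(A) = 0. *)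

(* Defs.v *)
From mathcomp Require Export all_boot all_order all_algebra.
From mathcomp Require Export all_classical all_reals all_analysis.
Export Order.TTheory GRing.Theory Num.Theory.
Export numFieldNormedType.Exports.

Set Implicit Arguments.
Unset Strict Implicit.
Unset Printing Implicit Defensive.

Local Open Scope classical_set_scope.
Local Open Scope ring_scope.

Definition signing (R : realType) (n : nat) (u : {ffun 'I_n -> bool}) : 'cV[R]_n :=
  \col_(j < n) (-1) ^+ u j.

(* On 'cV[R]_m the library norm is the sup norm (lemma mx_normrE). The neutral
   value of the iterated minimum is the value at the all-ones signing, so the
   minimum is over exactly the vectors of {-1, +1}^n. *)
Definition disc (R : realType) (m n : nat) (A : 'M[R]_(m, n)) : R :=
  \big[Num.min/`|A *m signing R [ffun=> false]|]_(u : {ffun 'I_n -> bool})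
    `|A *m signing R u|.

Definition mutually_independent (d d' : measure_display) (T : measurableType d)
    (T' : measurableType d') (R : realType) (P : probability T R) (I : finType)
    (X : I -> {RV P >-> T'}) : Prop :=
  forall (J : {set I}) (B : I -> set T'), (forall i, measurable (B i)) ->
    P (\bigcap_(i in [set` J]) (X i @^-1` B i)) =
    (\prod_(i in J) P (X i @^-1` B i))%E.

(* The second argument of the library's poisson_prob is unused. *)
Definition poisson_ensemble (d : measure_display) (T : measurableType d)
    (R : realType) (P : probability T R) (m n : nat)
    (A : 'I_m -> 'I_n -> {RV P >-> nat}) (lambda : R) : Prop :=
  mutually_independent (fun ij : 'I_m * 'I_n => A ij.1 ij.2) /\
  forall (i : 'I_m) (j : 'I_n) (U : set nat),
    distribution P (A i j) U = poisson_prob lambda 0 U.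

Definition sample (d : measure_display) (T : measurableType d)
    (R : realType) (P : probability T R) (m n : nat)
    (A : 'I_m -> 'I_n -> {RV P >-> nat}) (w : T) : 'M[R]_(m, n) :=
  \matrix_(i < m, j < n) (A i j w)%:R.

(* Main.v *)
Require Import Defs.
From mathcomp Require Import ring lra zify.

Set Implicit Arguments.
Unset Strict Implicit.
Unset Printing Implicit Defensive.

Local Open Scope classical_set_scope.
Local Open Scope ring_scope.

(** Second moment method over the signings [u = (sg, ~ sg)] of [N + N] columns.
  Given its sum [s], a row is multinomial, and a balanced signing makes the
  signed sum 0 or 1 in absolute value with probability
  [p_s = 'C(2H, H) / 2 ^ s], [H = uphalf s]. For two signings of correlation
  [rho] the conditional probability that both do so is a sum of
  [rho ^ k] against squared central Krawtchouk values, which is at most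
  [p_s ^ 2 / (1 - rho ^ 2)]. Dividing each row indicator by [p_s] makes the
  count of good signings have mean 1 whatever the row sums, and its second moment
  is at most [E exp (2 m rho ^ 2)], up to the event [rho ^ 2 > 1/2] where the
  crude factor [1 / p_s <= 1 + s] is used. Since [N rho] is a simple random walk
  at time [N], this is [1 + o(1)] once [N] dominates [m log m]. Conversely, one
  row with an odd sum forces the discrepancy to be at least 1, and all row
  sums are even only with probability [((1 + exp (- 2 mu)) / 2) ^ m]. *)

(** * Central values of Krawtchouk polynomials *)

Section Krawtchouk.
Variable R : realFieldType.
Implicit Types H k j : nat.

(* Krawtchouk polynomial of degree [H] on the cube of dimension [2 H], at [k]. *)
Definition central_krawtchouk H k : R :=
  ((1 + 'X) ^+ (H.*2 - k) * (1 - 'X) ^+ k)`_H.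

Lemma coef_exp1DX N k : ((1 + 'X : {poly R}) ^+ N)`_k = 'C(N, k)%:R.
Proof.
rewrite exprDn coef_sum.
transitivity (\sum_(i < N.+1) (if i == k :> nat then 'C(N, k)%:R else 0 : R)).
  apply: eq_bigr => i _; rewrite expr1n mul1r coefMn coefXn eq_sym.
  by case: eqP => [->|_]; rewrite ?mul0rn.
rewrite -big_mkcond /=; have [kN|Nk] := ltnP k N.+1.
  by rewrite (big_pred1 (Ordinal kN)).
by rewrite big1 ?bin_small.
Qed.

Lemma central_krawtchouk0 H : central_krawtchouk H 0 = 'C(H.*2, H)%:R.
Proof. by rewrite /central_krawtchouk subn0 expr0 mulr1 coef_exp1DX. Qed.

(* The operator [F |-> H F - X F'] kills the coefficient of degree [H]. *)
Lemma central_krawtchouk_rec H k : (k < H.*2)%N ->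
  (H.*2 - k)%:R * central_krawtchouk H k.+1 =
    - k%:R * central_krawtchouk H k.-1.
Proof.
move=> lk; rewrite /central_krawtchouk.
pose F : {poly R} := (1 + 'X) ^+ (H.*2 - k) * (1 - 'X) ^+ k.
have e0 : (H%:R *: F - 'X * F^`())`_H = 0.
  rewrite coefB coefZ coefXM; case: H lk @F => [//|h] lk F /=.
  by rewrite coef_deriv mulr_natl subrr.
(* The identities [1 + X - 2 X = 1 - X] and [1 - X + 2 X = 1 + X] shift the exponents. At [k = 0]
   the term in [k.-1] has coefficient 0. *)
have e1 : 2%:R *: (H%:R *: F - 'X * F^`()) =
   (H.*2 - k)%:R *: ((1 + 'X) ^+ (H.*2 - k.+1) * (1 - 'X) ^+ k.+1) +
   k%:R *: ((1 + 'X) ^+ (H.*2 - k.-1) * (1 - 'X) ^+ k.-1).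
  have ex (q : {poly R}) n : (q ^+ n)^`() = n%:R * q^`() * q ^+ n.-1.
    by rewrite deriv_exp -mulrA mulr_natl.
  rewrite /F derivM !ex derivD derivB derivX -polyC1 derivC.
  rewrite -!mul_polyC !polyC_natr.
  have HE : H%:R * 2 = (H.*2 - k)%:R + k%:R :> {poly R}.
    by rewrite -natrD subnK 1?ltnW// -muln2 natrM.
  have HE2 (G D : {poly R}) :
      2 * (H%:R * G - D) = ((H.*2 - k)%:R + k%:R) * G - 2 * D.
    by rewrite -HE; ring.
  rewrite HE2; have [b Hb] : exists b, (H.*2 - k = b.+1)%N.
    by exists (H.*2 - k).-1; lia.
  rewrite subnS Hb /=; case: k lk Hb {HE HE2 F e0} => [|k] lk Hb /=.
    by rewrite !exprS; ring.
  have -> : (H.*2 - k = b.+2)%N by lia.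
  by rewrite !exprS; ring.
have : (2%:R *: (H%:R *: F - 'X * F^`()))`_H = 0 by rewrite coefZ e0 mulr0.
by rewrite e1 coefD !coefZ mulNr => /eqP; rewrite addr_eq0 => /eqP.
Qed.

(** The recurrence at [k = 0] forces the value at 1 to vanish, and it then links indices two
    apart. *)
Lemma central_krawtchouk_odd H k : odd k -> (k <= H.*2)%N -> central_krawtchouk H k = 0.
Proof.
elim/ltn_ind: k => -[//|[|k]] IH ok kH.
  have := @central_krawtchouk_rec H 0 kH; rewrite oppr0 mul0r => /eqP.
  by rewrite mulf_eq0 pnatr_eq0 subn0 -leqn0 leqNgt kH => /eqP.
have ok' : odd k by move: ok; rewrite /= negbK.
have IHk : central_krawtchouk H k = 0 by apply: IH => //; lia.
have := @central_krawtchouk_rec H k.+1 kH; rewrite [_.-1]/= IHk mulr0 => /eqP.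
by rewrite mulf_eq0 pnatr_eq0 subn_eq0 leqNgt kH => /eqP.
Qed.

(** By the recurrence, the absolute value at [2 j] and ['C(H, j) / 'C(2 H, 2 j)] have the same
    successive ratios; ['C(2 H, H)] is the value at [j = 0]. *)
Lemma central_krawtchouk_even H j : (j <= H)%N ->
  'C(H.*2, j.*2)%:R * `|central_krawtchouk H j.*2| = 'C(H.*2, H)%:R * 'C(H, j)%:R.
Proof.
elim: j => [|j IH] jH.
  by rewrite !bin0 central_krawtchouk0 normr_nat mulrC.
have lt : (j.*2.+1 < H.*2)%N by lia.
have := @central_krawtchouk_rec H j.*2.+1 lt; rewrite /= -doubleS => e.
have {}IH := IH (ltnW jH).
have {e} e : (H.*2 - j.*2.+1)%:R * `|central_krawtchouk H j.+1.*2| =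
   j.*2.+1%:R * `|central_krawtchouk H j.*2|.
  by rewrite -[_%:R in LHS]normr_nat -normrM e normrM normrN normr_nat.
have /(congr1 (fun k => k%:R : R)) e3 := mul_bin_left H.*2 j.*2.+1.
have /(congr1 (fun k => k%:R : R)) e4 := mul_bin_left H.*2 j.*2.
have /(congr1 (fun k => k%:R : R)) e5 := mul_bin_left H j.
rewrite -doubleS !natrM in e3 e4 e5.
have nz1 : (j.*2.+1)%:R != 0 :> R by rewrite pnatr_eq0.
have nz2 : (H.*2 - j.*2.+1)%:R != 0 :> R by rewrite pnatr_eq0; lia.
have nz3 : (j.+1)%:R != 0 :> R by rewrite pnatr_eq0.
have d1 : j.+1.*2%:R = 2 * j.+1%:R :> R by rewrite -muln2 natrM mulrC.
have d2 : (H.*2 - j.*2)%:R = 2 * (H - j)%:R :> R by rewrite -doubleB -muln2 natrM mulrC.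
rewrite d1 in e3; rewrite d2 in e4; move: nz1 nz2 nz3 e e3 e4 e5 IH {d1 d2 lt jH}.
move: `|central_krawtchouk H j.*2| `|central_krawtchouk H j.+1.*2| => K0 K2.
move: 'C(H.*2, j.+1.*2)%:R 'C(H.*2, j.*2.+1)%:R 'C(H.*2, j.*2)%:R => c2 c1 c0.
move: 'C(H, j.+1)%:R 'C(H, j)%:R 'C(H.*2, H)%:R => b1 b0 c.
move: (j.*2.+1)%:R (H.*2 - j.*2.+1)%:R (j.+1)%:R (H - j)%:R => x y z w x0 y0 z0 e e3 e4 e5 IH.
apply: (mulfI x0); apply: (mulfI y0); apply: (mulfI z0).
transitivity (x * (c2 * z) * (y * K2)); first by ring.
transitivity (c * (z * b1) * x * y); last by ring.
rewrite e e5.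
transitivity (2^-1 * x * (2 * z * c2) * (x * K0)); first by field.
rewrite e3; transitivity (2^-1 * x * y * (x * c1) * K0); first by ring.
rewrite e4; transitivity (x * y * w * (c0 * K0)); first by field.
by rewrite IH; ring.
Qed.

(** The left side is one term of the Vandermonde sum for ['C(H + H, j + j)]. *)
Lemma sqr_bin_le H j : ('C(H, j) ^ 2 <= 'C(H.*2, j.*2))%N.
Proof.
have jj : (j < (j + j).+1)%N by lia.
rewrite -!addnn -binomial.Vandermonde.
rewrite (bigD1 (Ordinal jj)) //= addnK.
by rewrite -mulnn leq_addr.
Qed.

(** Weighted by ['C(2 H, k)], the squares are bounded uniformly in [k]; this reduces the second
    moment of a row to a geometric series. *)
Lemma central_krawtchouk_sqr_le H k : (k <= H.*2)%N ->
  'C(H.*2, k)%:R * central_krawtchouk H k ^+ 2 <= (~~ odd k)%:R * 'C(H.*2, H)%:R ^+ 2.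
Proof.
move=> kH; case: (boolP (odd k)) => [ok|/even_halfK ek].
  by rewrite central_krawtchouk_odd// expr0n mulr0 mul0r.
rewrite -ek in kH *; set j := k./2 in kH *; rewrite mul1r.
have jH : (j <= H)%N by lia.
have b0 : (0 : R) < 'C(H.*2, j.*2)%:R by rewrite ltr0n bin_gt0.
rewrite -(ler_pM2l b0) mulrA -expr2 -[X in _ * X]real_normK ?num_real// -exprMn.
rewrite central_krawtchouk_even// exprMn mulrC.
by rewrite ler_wpM2r ?sqr_ge0// -natrX ler_nat sqr_bin_le.
Qed.
End Krawtchouk.

(** * Multinomial theorem over a commutative ring *)

(* Coefficient [s] of a product of exponential series truncated at order [L] is
   that of the exponential series of the sum, as long as [s <= L]. *)
Section Multinomial.
Variables (R : realFieldType) (A : comNzRingType) (iota : {rmorphism R -> A}).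
Variable L : nat.

Definition trunc_exp (y : A) : {poly A} :=
  \poly_(k < L.+1) (iota (k`!%:R^-1) * y ^+ k).

Lemma coef_prod_trunc_exp n (y : 'I_n -> A) s : (s <= L)%N ->
  (\prod_j trunc_exp (y j))`_s = iota (s`!%:R^-1) * (\sum_j y j) ^+ s.
Proof.
elim: n y s => [|n IH] y s sL.
  rewrite !big_ord0 coef1 expr0n; case: s sL => [|s] _ /=; last by rewrite mulr0.
rewrite fact0 mulr1 (_ : 1%:R = 1) // invr1; exact: esym (rmorph1 iota).
rewrite !big_ord_recl coefM exprDn mulr_sumr.
rewrite (reindex_inj rev_ord_inj) /=; apply: eq_bigr => i _.
have le_is : (i <= s)%N by rewrite -ltnS.
rewrite subSS subKn// IH ?(leq_trans le_is)// coef_poly ifT; last first.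
  by rewrite ltnS (leq_trans (leq_subr _ _)).
rewrite -[X in _ = _ * X]mulr_natl -(rmorph_nat iota).
transitivity (iota ((s - i)`!%:R^-1 * i`!%:R^-1) *
  (y ord0 ^+ (s - i) * (\sum_(j < n) y (lift ord0 j)) ^+ i)).
  by rewrite rmorphM; ring.
rewrite [RHS]mulrA -rmorphM; congr (iota _ * _).
have := bin_fact le_is => /(congr1 (fun k => k%:R : R)); rewrite !natrM => <-.
have nz k : k`!%:R != 0 :> R by rewrite pnatr_eq0 -lt0n fact_gt0.
have nzb : 'C(s, i)%:R != 0 :> R by rewrite pnatr_eq0 -lt0n bin_gt0.
by field; rewrite !nz nzb.
Qed.

(** Applied with [A] equal to [R], [{poly R}] and [{poly {poly R}}]: each polynomial variable
    records the weight of one signing. *)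
Lemma multinomial n (y : 'I_n -> A) s : (s <= L)%N ->
  \sum_(a : {ffun 'I_n -> 'I_L.+1} | (\sum_j a j)%N == s)
     \prod_j (iota ((a j)`!%:R^-1) * y j ^+ a j) =
  iota (s`!%:R^-1) * (\sum_j y j) ^+ s.
Proof.
move=> sL; rewrite -coef_prod_trunc_exp//.
under [in RHS]eq_bigr do rewrite /trunc_exp poly_def.
rewrite bigA_distr_bigA coef_sum big_mkcond; apply: eq_bigr => a _ /=.
have -> : \prod_j ((iota ((a j)`!%:R^-1) * y j ^+ a j) *: 'X^(a j)) =
   (\prod_j (iota ((a j)`!%:R^-1) * y j ^+ a j)) *: 'X^(\sum_j a j)%N :> {poly A}.
  by rewrite scaler_prod -expr_sum.
by rewrite coefZ coefXn eq_sym; case: eqP => _; rewrite ?mulr1 ?mulr0.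
Qed.
End Multinomial.

(** * Exponential moments of the squared simple random walk *)

Section RandomWalk.
Variable R : realType.

(** For [x ^ 2 <= 1/2], the bounds [exp (x) <= 1 / (1 - x)] and [exp (- x) <= 1 / (1 + x)] average
    to [1 / (1 - x ^ 2) <= 1 + 2 x ^ 2]. Otherwise [|x| <= 2 x ^ 2]. *)
Lemma coshR_le (x : R) : (expR x + expR (- x)) / 2 <= expR (2 * x ^+ 2).
Proof.
have [x2|x2] := lerP (x ^+ 2) 2^-1.
  have := expR_ge1Dx x; have := expR_ge1Dx (- x); have := expR_ge1Dx (2 * x ^+ 2).
  have := expRxMexpNx_1 x; have := expR_gt0 x; have := expR_gt0 (- x).
  move: (expR x) (expR (- x)) (expR (2 * x ^+ 2)) => a b E b0 a0 ab hE hb ha.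
  have ax : a * (1 - x) <= 1 by rewrite -[leRHS]ab ler_pM2l.
  have bx : b * (1 + x) <= 1 by rewrite -[leRHS]ab mulrC ler_pM2r.
  have [l1 l2] : -1 < x /\ x < 1 by split; nra.
  have h1 : (a + b) * (1 - x ^+ 2) <= 2.
    have : a * (1 - x) * (1 + x) <= 1 * (1 + x) by apply: ler_wpM2r => //; lra.
    have : b * (1 + x) * (1 - x) <= 1 * (1 - x) by apply: ler_wpM2r => //; lra.
    by lra.
  have h2 : 1 <= E * (1 - x ^+ 2).
    apply: (@le_trans _ _ ((1 + 2 * x ^+ 2) * (1 - x ^+ 2))).
      by have := sqr_ge0 x; nra.
    by apply: ler_wpM2r => //; lra.
  rewrite -(@ler_pM2r _ (1 - x ^+ 2)); last by lra.
  by lra.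
have x0 : `|x| <= 2 * x ^+ 2.
  by rewrite -[x ^+ 2]real_normK ?num_real// in x2 *; have := normr_ge0 x; nra.
have h1 : expR x <= expR (2 * x ^+ 2).
  by rewrite ler_expR (le_trans (ler_norm _)).
have h2 : expR (- x) <= expR (2 * x ^+ 2).
  by rewrite ler_expR (le_trans (ler_norm _))// normrN.
by lra.
Qed.

(** Expectation of [f] at the position of the simple random walk after [k] steps, [j] of them
    downward. *)
Definition walk_mean k (f : R -> R) : R :=
  2^-1 ^+ k * \sum_(j < k.+1) 'C(k, j)%:R * f (k%:R - 2 * j%:R).

Lemma walk_meanS k f :
  walk_mean k.+1 f = walk_mean k (fun x => (f (x + 1) + f (x - 1)) / 2).
Proof.
rewrite /walk_mean exprSr -mulrA; congr (_ * _).
under [in RHS]eq_bigr do rewrite mulrA mulrDr mulrDl.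
rewrite big_split /= -!mulr_suml -[RHS]mulrDl [LHS]mulrC; congr (_ / _).
(* The extra term is zero because ['C(k, k.+1) = 0]; the ranges then match and Pascal's rule applies
   termwise. *)
have -> : \sum_(j < k.+1) 'C(k, j)%:R * f (k%:R - 2 * j%:R + 1) =
    \sum_(j < k.+2) 'C(k, j)%:R * f (k.+1%:R - 2 * j%:R).
  rewrite [RHS]big_ord_recr /= bin_small// mul0r addr0; apply: eq_bigr => j _.
  by congr (_ * f _); rewrite -(natr1 k); ring.
rewrite !(big_ord_recl k.+1) /= !bin0 -addrA; congr (_ + _).
rewrite -big_split /=; apply: eq_bigr => j _.
rewrite binS natrD mulrDl; congr (_ + _ * f _).
by rewrite -(natr1 k) -(natr1 j); ring.
Qed.

Lemma walk_mean_le k f g : (forall x, f x <= g x) -> walk_mean k f <= walk_mean k g.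
Proof.
move=> fg; apply: ler_wpM2l; first by rewrite exprn_ge0// invr_ge0.
by apply: ler_sum => j _; apply: ler_wpM2l.
Qed.

Lemma walk_meanZ k c f : walk_mean k (fun x => c * f x) = c * walk_mean k f.
Proof.
rewrite /walk_mean [in RHS]mulrCA; congr (_ * _); rewrite mulr_sumr.
by apply: eq_bigr => j _; rewrite mulrCA.
Qed.

(* One step multiplies [exp (t x^2)] by [exp t * cosh (2 t x)], so [t] becomes
   [t + 8 t ^ 2]; the condition [16 t k <= 1] is inherited by the remaining steps. *)
Lemma walk_mean_expR_sqr k (t : R) : 0 <= t -> 16 * t * k%:R <= 1 ->
  walk_mean k (fun x => expR (t * x ^+ 2)) <= expR (2 * t * k%:R).
Proof.
elim: k t => [|k IH] t t0 tk.
  by rewrite /walk_mean big_ord1 /= expr0 mul1r bin0 mul1r !(mulr0, subr0, expr0n).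
rewrite walk_meanS.
have tk' : 16 * t * k%:R + 16 * t <= 1 by move: tk; rewrite -(natr1 k) mulrDr mulr1.
have k0 : (0 : R) <= k%:R by [].
have : walk_mean k (fun x => expR t * expR ((t + 8 * t ^+ 2) * x ^+ 2)) <= expR (2 * t * k.+1%:R).
  rewrite walk_meanZ.
  apply: (@le_trans _ _ (expR t * expR (2 * (t + 8 * t ^+ 2) * k%:R))).
    rewrite ler_pM2l ?expR_gt0//; apply: IH; first by nra.
    rewrite -(natr1 k) in tk; nra.
  rewrite -expRD ler_expR -(natr1 k); nra.
apply: le_trans; apply: walk_mean_le => x.
have -> : t * (x + 1) ^+ 2 = (t + t * x ^+ 2) + 2 * t * x by ring.
have -> : t * (x - 1) ^+ 2 = (t + t * x ^+ 2) + - (2 * t * x) by ring.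
rewrite !(expRD (t + t * x ^+ 2)) -mulrDr -mulrA.
apply: le_trans (ler_wpM2l (expR_ge0 _) (coshR_le _)) _.
by rewrite -!expRD ler_expR; lra.
Qed.

Definition symdiff (T : finType) (A B : {set T}) : {set T} :=
  [set j | (j \in A) (+) (j \in B)].

(** For fixed [A], the map [symdiff A] is an involution, so the correlation of two uniform signings
    has the law of the walk at time [N]. *)
Lemma mean_symdiff N (f : R -> R) :
  2^-1 ^+ N * 2^-1 ^+ N * \sum_(A : {set 'I_N}) \sum_(B : {set 'I_N})
     f (N%:R - 2 * #|symdiff A B|%:R) = walk_mean N f.
Proof.
have inner (A : {set 'I_N}) : 
   \sum_(B : {set 'I_N}) f (N%:R - 2 * #|symdiff A B|%:R) =
   \sum_(j < N.+1) 'C(N, j)%:R * f (N%:R - 2 * j%:R).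
  have inv : involutive (symdiff A).
    by move=> B; apply/setP => j; rewrite !inE addbA addbb.
  rewrite (reindex_inj (inv_inj inv)) /=.
  under eq_bigr do rewrite inv.
  have lt (B : {set 'I_N}) : (#|B| < N.+1)%N by rewrite ltnS -[leqRHS]card_ord max_card.
  rewrite (partition_big (fun B : {set 'I_N} => Ordinal (lt B)) xpredT) //=.
  apply: eq_bigr => j _.
  rewrite (eq_bigr (fun _ => f (N%:R - 2 * j%:R))); last by move=> B /eqP <-.
  rewrite sumr_const [RHS]mulr_natl; congr (_ *+ _).
  have := card_draws 'I_N j; rewrite card_ord => <-.
  by apply: eq_card => B; rewrite !inE.
under eq_bigr do rewrite inner.
rewrite sumr_const -/(powerset _) -cardsT -powersetT card_powerset cardsT card_ord.
rewrite -[X in _ * X]mulr_natl natrX /walk_mean.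
by rewrite -mulrA; congr (_ * _); rewrite mulrA -exprMn mulVf ?expr1n ?mul1r.
Qed.

End RandomWalk.

(** * Balanced splittings of a row as polynomial coefficients *)

Section Balance.
Variable n : nat.
Implicit Types (a : 'I_n -> nat) (u : pred 'I_n).

(* The weights of [u] and of its complement differ by at most 1. *)
Definition balanced_at a u : bool :=
  let s := (\sum_j a j)%N in let U := (\sum_(j | u j) a j)%N in
  (U == uphalf s) || odd s && (U.+1 == uphalf s).

(* The factor [1 + 'X], present when the sum is odd, merges the two admissible
   weights into one coefficient. *)
Lemma coef_balanced_at (R : realFieldType) a u (s := (\sum_j a j)%N) :
  ('X^(\sum_(j | u j) a j)%N * (1 + 'X) ^+ (odd s))`_(uphalf s) =
    (balanced_at a u)%:R :> R.
Proof.
rewrite coefXnM coef_exp1DX /balanced_at -/s.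
move: (\sum_(j | u j) a j)%N (uphalf s) (odd s) => {s} U H e.
have [lt|le] := ltnP H U.
  by rewrite gtn_eqF//= (gtn_eqF (leqW lt)) andbF.
have [->|ne] := eqVneq U H; first by rewrite subnn bin0.
have {ne}le : (U < H)%N by rewrite ltn_neqAle ne.
case: e => /=; last by rewrite bin0n subn_eq0 leqNgt le.
have [<-|ne] := eqVneq U.+1 H; first by rewrite subSnn.
by rewrite bin_small// ltn_subRL addn1 ltn_neqAle ne.
Qed.

Lemma balanced_at_le1 a u (x := (\sum_(j | u j) a j)%N) (y := (\sum_(j | ~~ u j) a j)%N) :
  balanced_at a u -> (x <= y.+1)%N && (y <= x.+1)%N.
Proof.
rewrite /balanced_at [(\sum_j a j)%N](bigID u) /= -/x -/y; move: x y => x y.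
rewrite uphalf_half; have := odd_double_half (x + y); case: (odd _) => /=; lia.
Qed.

End Balance.

(** * Central binomial coefficients and even geometric sums *)

Lemma bin_central_lbound H : (4 ^ H <= H.+1 * 'C(H.*2, H))%N.
Proof.
elim: H => // H IH.
rewrite doubleS expnS.
have e3 : (H.+1 * 'C(H.*2.+2, H.+1) = 2 * (H.*2.+1 * 'C(H.*2, H)))%N.
  have -> : (H.*2.+1 * 'C(H.*2, H) = H.+1 * 'C(H.*2.+1, H))%N.
    by have /= -> := mul_bin_down H.*2.+1 H; congr (_ * _)%N; lia.
  by have /= <- := mul_bin_diag H.*2.+2 H; rewrite -doubleS -mul2n mulnA.
(* After cancellation this is [4 (H + 1) ^ 2 <= 2 (2 H + 1) (H + 2)]. *)
have h : (4 * (H.+1 * 'C(H.*2, H)) * H.+1 <= H.+2 * 'C(H.*2.+2, H.+1) * H.+1)%N.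
  rewrite -[leqRHS]mulnA [('C(_, _) * _)%N]mulnC e3.
  rewrite [leqLHS](_ : _ = 'C(H.*2, H) * (4 * (H.+1 * H.+1)))%N; last by lia.
  rewrite [leqRHS](_ : _ = 'C(H.*2, H) * (2 * (H.*2.+1 * H.+2)))%N; last by lia.
  by rewrite leq_mul2l -!mul2n; apply/orP; right; lia.
move: h; rewrite leq_pmul2r// => h; apply: leq_trans h.
by rewrite leq_mul2l IH orbT.
Qed.

(** Since [uphalf s <= s <= 2 * uphalf s], the central bound applies; it makes the balance
    probability of a row of sum [s] at least [1 / (s + 1)]. *)
Lemma exp2_le_bin_central s : (2 ^ s <= s.+1 * 'C((uphalf s).*2, uphalf s))%N.
Proof.
have h := bin_central_lbound (uphalf s).
have le : (2 ^ s <= 4 ^ uphalf s)%N.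
  by rewrite (_ : 4 = 2 ^ 2)%N// -expnM leq_exp2l//; lia.
apply: leq_trans (leq_trans le h) _; rewrite leq_mul2r.
by apply/orP; right; lia.
Qed.

(** Peeling off two terms gives [S_(n+2) = 1 + r ^ 2 * S_n], whose fixed point is the right side. *)
Lemma sum_even_exp_le (R : realFieldType) (r : R) n : r ^+ 2 < 1 ->
  \sum_(k < n) (~~ odd k)%:R * r ^+ k <= (1 - r ^+ 2)^-1.
Proof.
move=> r1; have d0 : 0 < 1 - r ^+ 2 by rewrite subr_gt0.
have r0 := sqr_ge0 r.
rewrite -[leRHS]mul1r ler_pdivlMr//.
elim/ltn_ind: n => -[|[|n]] IH; first by rewrite big_ord0 mul0r.
  by rewrite big_ord1 /= expr0; lra.
rewrite !big_ord_recl /= mul0r add0r mulr1.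
under eq_bigr => k _.
  rewrite /bump /= !add1n /= negbK (_ : _ * _ = r ^+ 2 * ((~~ odd k)%:R * r ^+ k)); last first.
    by rewrite !exprS; ring.
  over.
rewrite -mulr_sumr.
have := IH n (leqW (leqnn _)); nra.
Qed.

(** * First and second moments of balance at a fixed row sum *)

Section RowMoments.
Variables (R : realFieldType) (N L : nat).
Local Notation row := {ffun 'I_(N + N) -> 'I_L.+1}.
Local Notation bal a := (balanced_at (fun j => nat_of_ord (a j))).
Implicit Types (sg tu : {set 'I_N}) (a : row).

(** The second half of the columns carries the complement, so each sign occurs exactly [N] times
    whatever [sg] is. *)
Definition spin sg (j : 'I_(N + N)) : bool :=
  match fintype.split j with inl i => i \in sg | inr i => i \notin sg end.

Lemma sum_spin2 (V : nmodType) (y : bool -> bool -> V) sg tu :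
  \sum_j y (spin sg j) (spin tu j) =
  \sum_(i < N) (y (i \in sg) (i \in tu) + y (i \notin sg) (i \notin tu)).
Proof.
rewrite big_split_ord /= big_split /=; congr (_ + _); apply: eq_bigr => i _.
  by rewrite /spin (unsplitK (inl i)).
by rewrite /spin (unsplitK (inr i)).
Qed.

(** The Poisson weight of a row without the factors that depend only on its sum. *)
Definition row_mass a : R := \prod_j (a j)`!%:R^-1.

Lemma sum_row_mass s : (s <= L)%N ->
  \sum_(a : row | (\sum_j a j)%N == s) row_mass a = (N + N)%:R ^+ s / s`!%:R.
Proof.
move=> sL; have := multinomial (idfun : {rmorphism R -> R}) (fun _ : 'I_(N + N) => 1) sL.
rewrite /= sumr_const card_ord mulrC => <-.
by apply: eq_bigr => a _; apply: eq_bigr => j _; rewrite expr1n mulr1.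
Qed.

(** Marking the columns of the signing by [X] gives the linear form [N (1 + X)]. With the factor
    [(1 + X) ^ odd s] the exponent becomes [2 * uphalf s], and its central coefficient is read
    off. *)
Lemma sum_row_mass_balanced sg s : (s <= L)%N ->
  \sum_(a : row | (\sum_j a j)%N == s) row_mass a * (bal a (spin sg))%:R =
  N%:R ^+ s / s`!%:R * 'C((uphalf s).*2, uphalf s)%:R.
Proof.
move=> sL.
pose y (j : 'I_(N + N)) : {poly R} := 'X^(spin sg j).
have := multinomial (@polyC R) y sL.
move/(congr1 (fun p => (p * (1 + 'X) ^+ odd s)`_(uphalf s))).
have -> : \sum_j y j = N%:R%:P * (1 + 'X).
  rewrite /y (sum_spin2 (fun b _ => 'X^b) sg sg).
  rewrite (eq_bigr (fun=> 1 + 'X)) ?sumr_const ?card_ord ?polyC_natr ?mulr_natl// => i _.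
  by case: (i \in sg); rewrite /= expr1 expr0 // addrC.
have -> : (s`!%:R^-1)%:P * (N%:R%:P * (1 + 'X)) ^+ s * (1 + 'X) ^+ odd s =
    (s`!%:R^-1 * N%:R ^+ s)%:P * (1 + 'X) ^+ (s + odd s) :> {poly R}.
  by rewrite polyCM polyC_exp exprMn exprD; ring.
rewrite coefCM coef_exp1DX.
have -> : (s + odd s = (uphalf s).*2)%N by rewrite uphalf_half; lia.
rewrite [_^-1 * _]mulrC => <-; rewrite mulr_suml coef_sum; apply: eq_bigr => a /eqP as_.
rewrite big_split /= -rmorph_prod /= -/(row_mass a) -mulrA coefCM; congr (_ * _).
rewrite -coef_balanced_at as_.
suff -> : \prod_j y j ^+ a j = 'X^(\sum_(j | spin sg j) a j)%N by [].
rewrite [in RHS]big_mkcond expr_sum; apply: eq_bigr => j _.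
by rewrite /y -exprM; case: (spin _ _); rewrite ?mul1n.
Qed.

(** The inner variable [z] marks the first signing and the outer [X] the second. Each term of the
    binomial expansion is a polynomial in [z] times the same polynomial in [X], hence the squared
    Krawtchouk value. *)
Lemma sum_row_mass_balanced2 sg tu s (S := N%:R - 2 * #|symdiff sg tu|%:R : R) : (s <= L)%N ->
  \sum_(a : row | (\sum_j a j)%N == s)
     row_mass a * (bal a (spin sg))%:R * (bal a (spin tu))%:R =
  s`!%:R^-1 * \sum_(k < s.+1) 'C(s, k)%:R * (N%:R / 2) ^+ (s - k) * (S / 2) ^+ k *
     central_krawtchouk R (uphalf s) k ^+ 2.
Proof.
move=> sL; set H := uphalf s; set e := odd s.
have [iota iotaE] : exists iota : {rmorphism R -> {poly {poly R}}}, forall c, iota c = c%:P%:P.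
  by exists (@polyC {poly R} \o @polyC R).
pose z : {poly {poly R}} := 'X%:P.
pose y j : {poly {poly R}} := z ^+ (spin sg j) * 'X ^+ (spin tu j).
have := multinomial iota y sL.
move/(congr1 (fun p => (p * ((1 + z) ^+ e * (1 + 'X) ^+ e))`_H`_H)).
have coefzw (c : R) (F G : {poly R}) :
    (iota c * (F%:P * map_poly polyC G))`_H`_H = c * (F`_H * G`_H).
  by rewrite iotaE !coefCM coef_map /= coefMC.
have ezP k : (1 + z) ^+ k = ((1 + 'X) ^+ k)%:P.
  by rewrite polyC_exp polyCD polyC1.
have ewP k : (1 + 'X) ^+ k = map_poly polyC ((1 + 'X : {poly R}) ^+ k).
  by rewrite rmorphXn rmorphD rmorph1 /= map_polyX.
have ezM k : (1 - z) ^+ k = ((1 - 'X) ^+ k)%:P.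
  by rewrite polyC_exp polyCB polyC1.
have ewM k : (1 - 'X) ^+ k = map_poly polyC ((1 - 'X : {poly R}) ^+ k).
  by rewrite rmorphXn rmorphB rmorph1 /= map_polyX.
(* With [D] the size of the symmetric difference, the form [(N - D) (1 + z X) + D (z + X)] is
   rewritten in the products [(1 + z) (1 + X)] and [(1 - z) (1 - X)]. *)
have -> : \sum_j y j = iota (N%:R / 2) * ((1 + z) * (1 + 'X)) +
    iota (S / 2) * ((1 - z) * (1 - 'X)).
  rewrite /y (sum_spin2 (fun b c => z ^+ b * 'X ^+ c) sg tu).
  transitivity (\sum_(i < N) ((1 + z * 'X) + iota ((i \in symdiff sg tu)%:R) * (z + 'X - (1 + z * 'X)))).
    apply: eq_bigr => i _; rewrite inE.
    by case: (i \in sg); case: (i \in tu); rewrite /= ?rmorph1 ?rmorph0 ?expr1 ?expr0; ring.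
  rewrite big_split /= sumr_const card_ord -mulr_suml -(rmorph_sum iota).
  have -> : \sum_(i < N) (i \in symdiff sg tu)%:R = #|symdiff sg tu|%:R :> R.
    by rewrite -sum1_card natr_sum [RHS]big_mkcond; apply: eq_bigr => i _; case: ifP.
  have i2 : iota 2^-1 * 2 = 1 by rewrite -(rmorph_nat iota) -rmorphM mulVf ?rmorph1 ?pnatr_eq0.
  rewrite /S !(rmorphM iota) (rmorphB iota) (rmorphM iota) !(rmorph_nat iota).
  move: (iota 2^-1) i2 => h i2.
  set D := #|_|%:R; transitivity (h * 2 * (N%:R * (1 + z * 'X) + D * (z + 'X - (1 + z * 'X)))).
    by rewrite i2 mul1r mulr_natl.
  by ring.
rewrite mulr_suml !coef_sum => lhs.
transitivity (\sum_(a : row | (\sum_j a j)%N == s)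
   (\prod_j (iota (a j)`!%:R^-1 * y j ^+ a j) * ((1 + z) ^+ e * (1 + 'X) ^+ e))`_H`_H).
  apply: eq_bigr => a /eqP as_; rewrite -!coef_balanced_at as_ -/H -/e -mulrA -coefzw.
  apply: (congr1 (fun p : {poly {poly R}} => p`_H`_H)); rewrite big_split /= -(rmorph_prod iota) -mulrA; congr (_ * _).
  rewrite polyCM rmorphM /= -ezP -ewP mulrACA; congr (_ * _).
  have zX k : z ^+ k = ('X^k)%:P by rewrite polyC_exp.
  rewrite map_polyXn -zX !(big_mkcond (fun j => spin _ j)) !expr_sum -big_split /=.
  apply: eq_bigr => j _; rewrite /y exprMn -!exprM.
  by do 2 (case: (spin _ _)); rewrite ?mul1n ?mul0n.
rewrite {}lhs.
have -> : iota (s`!%:R^-1) * (iota (N%:R / 2) * ((1 + z) * (1 + 'X)) +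
     iota (S / 2) * ((1 - z) * (1 - 'X))) ^+ s * ((1 + z) ^+ e * (1 + 'X) ^+ e) =
  iota (s`!%:R^-1) * \sum_(k < s.+1)
   iota ('C(s, k)%:R * (N%:R / 2) ^+ (s - k) * (S / 2) ^+ k) *
    (((1 + 'X) ^+ (H.*2 - k) * (1 - 'X) ^+ k)%:P *
     map_poly polyC ((1 + 'X) ^+ (H.*2 - k) * (1 - 'X) ^+ k)).
  rewrite exprDn -mulrA; congr (_ * _); rewrite mulr_suml; apply: eq_bigr => k _.
  have -> : (H.*2 - k = (s - k) + e)%N by rewrite /H uphalf_half /e; have := ltn_ord k; lia.
  rewrite [iota (_ * _ * _)](rmorphM iota) [iota (_ * _ ^+ _)](rmorphM iota).
  rewrite !(rmorphXn iota) (rmorph_nat iota) -mulr_natl.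
  move: (iota (N%:R / 2)) (iota (S / 2)) => p q.
  rewrite polyCM rmorphM /= -!ezP -!ezM -!ewP -!ewM !exprMn !exprD.
  by ring.
rewrite iotaE !coefCM; congr (_ * _); rewrite !coef_sum; apply: eq_bigr => k _.
by rewrite coefzw expr2.
Qed.
End RowMoments.

(** Put [S = N rho] and enlarge ['C(s, k)] to ['C(2 H, k)]: the Krawtchouk bound leaves the even
    powers of [rho]. Odd [k] contribute nothing, so the sign of [rho] is harmless. *)
Lemma sum_row_mass_balanced2_le (R : realFieldType) (N L : nat) (sg tu : {set 'I_N}) s
    (rho : R := (N%:R - 2 * #|symdiff sg tu|%:R) / N%:R) :
  (s <= L)%N -> (0 < N)%N -> rho ^+ 2 < 1 ->
  \sum_(a : {ffun 'I_(N + N) -> 'I_L.+1} | (\sum_j a j)%N == s)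
     row_mass R a * (balanced_at (fun j => nat_of_ord (a j)) (spin sg))%:R *
       (balanced_at (fun j => nat_of_ord (a j)) (spin tu))%:R <=
  (N%:R / 2) ^+ s / s`!%:R * 'C((uphalf s).*2, uphalf s)%:R ^+ 2 / (1 - rho ^+ 2).
Proof.
move=> sL N0 rho1; rewrite sum_row_mass_balanced2//; set S := (_ - _) in rho rho1 *.
have NR : 0 < N%:R :> R by rewrite ltr0n.
set H := uphalf s; set B : R := 'C(H.*2, H)%:R.
rewrite (mulrC ((N%:R / 2) ^+ s)) -!mulrA ler_wpM2l ?invr_ge0//.
have -> : S = N%:R * rho by rewrite /rho mulrC divfK ?gt_eqF.
rewrite (eq_bigr (fun k : 'I_s.+1 => (N%:R / 2) ^+ s *
  ('C(s, k)%:R * rho ^+ k * central_krawtchouk R H k ^+ 2))); last first.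
  move=> k _; have -> : (N%:R / 2) ^+ s = (N%:R / 2) ^+ (s - k) * (N%:R / 2) ^+ k :> R.
    by rewrite -exprD subnK// -ltnS.
  have -> : (N%:R * rho / 2) ^+ k = (N%:R / 2) ^+ k * rho ^+ k by rewrite mulrAC exprMn.
  by ring.
rewrite -mulr_sumr ler_wpM2l ?exprn_ge0 ?divr_ge0//.
apply: (@le_trans _ _ (B ^+ 2 * \sum_(k < s.+1) (~~ odd k)%:R * rho ^+ k)); last first.
  by rewrite mulrA -expr2 ler_wpM2l ?sqr_ge0// sum_even_exp_le.
rewrite mulr_sumr; apply: ler_sum => k _.
have sH : (s <= H.*2)%N by rewrite /H uphalf_half; lia.
have kH : (k <= H.*2)%N by rewrite (leq_trans _ sH)// -ltnS.
case: (boolP (odd k)) => [ok|ek].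
  by rewrite central_krawtchouk_odd// expr0n mulr0 mul0r mulr0.
have rk : 0 <= rho ^+ k by rewrite exprn_even_ge0.
rewrite mul1r mulrAC ler_wpM2r//.
have := central_krawtchouk_sqr_le R kH; rewrite ek mul1r.
by apply: le_trans; rewrite ler_wpM2r ?sqr_ge0// ler_nat leq_bin2l.
Qed.

(** * Truncated Poisson rows and normalised balance indicators *)

Section TruncatedPoisson.
Variables (R : realType) (N L : nat) (la : R).
Hypotheses (N_gt0 : (0 < N)%N) (la_gt0 : 0 < la).
Local Notation row := {ffun 'I_(N + N) -> 'I_L.+1}.
Local Notation bal a := (balanced_at (fun j => nat_of_ord (a j))).
Implicit Types (sg tu : {set 'I_N}) (a : row) (s : nat).

Let mu : R := (N + N)%:R * la.

Let mu_gt0 : 0 < mu.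
Proof. by rewrite mulr_gt0// ltr0n addn_gt0 N_gt0. Qed.

Let pmfE s : poisson_pmf mu s = expR (- mu) * la ^+ s * ((N + N)%:R ^+ s / s`!%:R).
Proof. by rewrite /poisson_pmf mu_gt0 /mu exprMn; ring. Qed.

(* Only rows of sum at most [L] are kept, so that the row space is finite and all
   its levels are complete; [L] tends to infinity in [prob_disc_ge]. *)
Definition trunc_weight a : R :=
  ((\sum_j a j)%N <= L)%:R * \prod_j poisson_pmf la (a j).

Lemma trunc_weight_ge0 a : 0 <= trunc_weight a.
Proof. by rewrite mulr_ge0// prodr_ge0// => j _; rewrite poisson_pmf_ge0. Qed.

Lemma prod_poisson_pmf a : \prod_j poisson_pmf la (a j) =
  expR (- mu) * la ^+ (\sum_j a j)%N * row_mass R a.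
Proof.
rewrite /poisson_pmf la_gt0 !big_split /= -expr_sum mulrC mulrA; congr (_ * _ * _).
by rewrite prodr_const card_ord -expRM_natl mulrN mulr_natl -mulr_natl.
Qed.

Lemma sum_trunc_weight (f : row -> R) :
  \sum_a trunc_weight a * f a = \sum_(s < L.+1) expR (- mu) * la ^+ s *
    \sum_(a : row | (\sum_j a j)%N == s) row_mass R a * f a.
Proof.
rewrite (bigID (fun a : row => ((\sum_j a j)%N <= L)%N)) /= [X in _ + X]big1 ?addr0; last first.
  by move=> a /negbTE aL; rewrite /trunc_weight aL !mul0r.
(* [inord] is exact here, since the remaining rows have sum at most [L]. *)
rewrite (partition_big (fun a : row => inord (\sum_j a j)%N : 'I_L.+1) xpredT)//=.
apply: eq_bigr => s _; rewrite mulr_sumr; apply: eq_big => [a|a /andP[aL /eqP <-]].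
  apply/andP/eqP => [[aL /eqP <-]|as_]; first by rewrite inordK.
  by rewrite as_ inord_val -ltnS; split.
by rewrite /trunc_weight aL mul1r prod_poisson_pmf inordK// mulrA.
Qed.

Definition trunc_mass : R := \sum_(s < L.+1) poisson_pmf mu s.

Definition balance_prob s : R := 'C((uphalf s).*2, uphalf s)%:R / 2 ^+ s.

Lemma balance_prob_gt0 s : 0 < balance_prob s.
Proof. by rewrite divr_gt0 ?exprn_gt0// ltr0n bin_gt0 -addnn leq_addr. Qed.

Lemma balance_prob_inv_le s : (balance_prob s)^-1 <= 1 + s%:R.
Proof.
rewrite invf_div ler_pdivrMr ?ltr0n ?bin_gt0 -?addnn ?leq_addr//.
by rewrite addnn nat1r -natrM -natrX ler_nat exp2_le_bin_central.
Qed.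

Definition balance_ratio sg a : R :=
  (bal a (spin sg))%:R / balance_prob (\sum_j a j)%N.

Lemma balance_ratio_ge0 sg a : 0 <= balance_ratio sg a.
Proof. by rewrite divr_ge0// ltW// balance_prob_gt0. Qed.

(** The [2 ^ s] in [balance_prob] compensates for [N ^ s] against [(N + N) ^ s], so the ratio has
    conditional mean 1 at every row sum. *)
Lemma level_balance_ratio sg s : (s <= L)%N ->
  expR (- mu) * la ^+ s *
    \sum_(a : row | (\sum_j a j)%N == s) row_mass R a * balance_ratio sg a =
  poisson_pmf mu s.
Proof.
move=> sL; rewrite pmfE; congr (_ * _).
under eq_bigr => a /eqP as_ do rewrite /balance_ratio as_ mulrA.
rewrite -mulr_suml sum_row_mass_balanced// /balance_prob natrD -mulr2n -[N%:R *+ 2]mulr_natl exprMn.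
have c0 : 'C((uphalf s).*2, uphalf s)%:R != 0 :> R.
  by rewrite pnatr_eq0 -lt0n bin_gt0 -addnn leq_addr.
by field; rewrite c0 pnatr_eq0 -lt0n fact_gt0 expf_neq0 ?pnatr_eq0.
Qed.

Lemma sum_balance_ratio sg : \sum_a trunc_weight a * balance_ratio sg a = trunc_mass.
Proof.
by rewrite sum_trunc_weight; apply: eq_bigr => s _; rewrite level_balance_ratio// -ltnS.
Qed.

Definition balance_corr sg tu : R :=
  \sum_a trunc_weight a * (balance_ratio sg a * balance_ratio tu a).

Lemma balance_corr_ge0 sg tu : 0 <= balance_corr sg tu.
Proof.
apply: sumr_ge0 => a _; apply: mulr_ge0; first exact: trunc_weight_ge0.
by apply: mulr_ge0; exact: balance_ratio_ge0.
Qed.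

Lemma balance_corr_le sg tu (rho : R := (N%:R - 2 * #|symdiff sg tu|%:R) / N%:R) :
  rho ^+ 2 < 1 -> balance_corr sg tu <= trunc_mass / (1 - rho ^+ 2).
Proof.
move=> rho1; rewrite /balance_corr sum_trunc_weight mulr_suml; apply: ler_sum => s _.
have sL : (s <= L)%N by rewrite -ltnS.
rewrite (eq_bigr (fun a : row => row_mass R a * (bal a (spin sg))%:R * (bal a (spin tu))%:R /
  balance_prob s ^+ 2)); last first.
  by move=> a /eqP as_; rewrite /balance_ratio as_ -exprVn; ring.
rewrite -mulr_suml pmfE -[leRHS]mulrA ler_wpM2l ?mulr_ge0 ?expR_ge0 ?exprn_ge0 ?(ltW la_gt0)//.
rewrite ler_pdivrMr ?exprn_gt0 ?balance_prob_gt0//.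
apply: le_trans (sum_row_mass_balanced2_le sL N_gt0 rho1) _; rewrite -/rho.
clearbody rho.
rewrite le_eqVlt; apply/orP; left; apply/eqP.
rewrite /balance_prob natrD -mulr2n -[N%:R *+ 2]mulr_natl !exprMn exprVn.
have c0 : 'C((uphalf s).*2, uphalf s)%:R != 0 :> R.
  by rewrite pnatr_eq0 -lt0n bin_gt0 -addnn leq_addr.
have d0 : 1 - rho ^+ 2 != 0 by rewrite subr_eq0 gt_eqF.
move: (1 - rho ^+ 2) d0 => d d0; field; rewrite d0 pnatr_eq0 -lt0n fact_gt0.
by rewrite expf_neq0 ?pnatr_eq0.
Qed.

(** Serves nearly parallel or opposite signings: one ratio is bounded by [1 / p_s <= 1 + s], and the
    other has mean 1 on each level. *)
Lemma balance_corr_le_mean sg tu :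
  balance_corr sg tu <= \sum_(s < L.+1) (1 + s%:R) * poisson_pmf mu s.
Proof.
apply: (@le_trans _ _ (\sum_a trunc_weight a * ((1 + (\sum_j a j)%N%:R) * balance_ratio sg a))).
  apply: ler_sum => a _; rewrite ler_wpM2l ?trunc_weight_ge0// mulrC.
  rewrite ler_wpM2r ?balance_ratio_ge0// (le_trans _ (balance_prob_inv_le _))//.
  by rewrite /balance_ratio; case: (bal _ _); rewrite ?mul1r ?mul0r// invr_ge0 ltW// balance_prob_gt0.
rewrite sum_trunc_weight; apply: ler_sum => s _.
have sL : (s <= L)%N by rewrite -ltnS.
rewrite -(level_balance_ratio sg sL) mulrCA le_eqVlt; apply/orP; left; apply/eqP.
congr (_ * _); rewrite mulr_sumr; apply: eq_bigr => a /eqP ->; exact: mulrCA.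
Qed.

Lemma sum_trunc_weight_even :
  \sum_a trunc_weight a * (~~ odd (\sum_j a j)%N)%:R =
  \sum_(s < L.+1) (~~ odd s)%:R * poisson_pmf mu s.
Proof.
rewrite sum_trunc_weight; apply: eq_bigr => s _; rewrite pmfE mulrCA.
rewrite -(sum_row_mass _ _ (ltn_ord s : (s <= L)%N)); congr (_ * _).
by rewrite mulr_sumr; apply: eq_bigr => a /eqP ->; rewrite mulrC.
Qed.

End TruncatedPoisson.

(** * Partial sums of the Poisson law: mass, even part, mean *)

Section PoissonSums.
Variables (R : realType) (mu : R).
Hypothesis mu_gt0 : 0 < mu.

Lemma sum_poisson_pmfE n :
  \sum_(s < n) poisson_pmf mu s = expR (- mu) * series (exp_coeff mu) n.
Proof.
rewrite /series /= big_mkord mulr_sumr; apply: eq_bigr => s _.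
by rewrite /poisson_pmf mu_gt0 /exp_coeff /= mulrC.
Qed.

Lemma cvg_sum_poisson_pmf :
  ((fun n => \sum_(s < n) poisson_pmf mu s) @ \oo --> (1 : R))%classic.
Proof.
rewrite (_ : (fun n => _) = (fun n => expR (- mu) * series (exp_coeff mu) n)); last first.
  by apply/funext => n; rewrite sum_poisson_pmfE.
rewrite -(expRxMexpNx_1 mu) mulrC; apply: cvgMr.
exact: is_cvg_series_exp_coeff.
Qed.

Lemma sum_poisson_pmf_le1 n : \sum_(s < n) poisson_pmf mu s <= 1.
Proof.
rewrite -[leRHS](cvg_lim _ cvg_sum_poisson_pmf)//.
apply: (@nondecreasing_cvgn_le _ (fun n => \sum_(s < n) poisson_pmf mu s)).
  apply/nondecreasing_seqP => k; rewrite big_ord_recr /= lerDl.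
  exact: poisson_pmf_ge0.
by apply/cvg_ex; exists 1; exact: cvg_sum_poisson_pmf.
Qed.

(** Averaging the series for [mu] and [- mu] keeps the even terms; the partial sums increase to the
    limit on the right. *)
Lemma sum_even_poisson_pmf_le n :
  \sum_(s < n) (~~ odd s)%:R * poisson_pmf mu s <= (1 + expR (- (2 * mu))) / 2.
Proof.
pose u k := \sum_(s < k) (~~ odd s)%:R * poisson_pmf mu s.
have cu : (u @ \oo --> (1 + expR (- (2 * mu))) / 2)%classic.
  rewrite (_ : u = (fun k => (\sum_(s < k) poisson_pmf mu s +
      expR (- mu) * series (exp_coeff (- mu)) k) / 2)); last first.
    apply/funext => k; rewrite /series /= big_mkord mulr_sumr -big_split mulr_suml /=.
    apply: eq_bigr => s _; rewrite /poisson_pmf mu_gt0 /exp_coeff /= exprNn -signr_odd.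
    by case: (odd s) => /=; field; rewrite pnatr_eq0 -lt0n fact_gt0.
  apply: cvgMl; apply: cvgD; first exact: cvg_sum_poisson_pmf.
  rewrite (_ : - (2 * mu) = - mu - mu) ?expRD; last by ring.
  by apply: cvgMr; exact: is_cvg_series_exp_coeff.
rewrite -[leRHS](cvg_lim _ cu)//; apply: (@nondecreasing_cvgn_le _ u).
  apply/nondecreasing_seqP => k; rewrite /u big_ord_recr /= lerDl.
  by rewrite mulr_ge0// poisson_pmf_ge0.
by apply/cvg_ex; eexists; exact: cu.
Qed.

(** The mean part telescopes through [s * pmf s = mu * pmf (s - 1)]. *)
Lemma poisson_mean_le n : \sum_(s < n) (1 + s%:R) * poisson_pmf mu s <= 1 + mu.
Proof.
under eq_bigr do rewrite mulrDl mul1r.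
rewrite big_split /= lerD ?sum_poisson_pmf_le1//.
case: n => [|n]; first by rewrite big_ord0 ltW.
rewrite big_ord_recl mul0r add0r -[leRHS]mulr1.
apply: le_trans (ler_wpM2l (ltW mu_gt0) (sum_poisson_pmf_le1 n)).
rewrite mulr_sumr; apply: ler_sum => s _; rewrite lift0 /poisson_pmf mu_gt0 factS natrM.
rewrite le_eqVlt; apply/orP; left; apply/eqP; rewrite exprS.
by field; rewrite nat1r !pnatr_eq0 -lt0n fact_gt0.
Qed.

End PoissonSums.

(** * Second moment of the normalised count of balanced signings *)

Section SecondMoment.
Variables (R : realType) (N m L : nat) (la : R).
Hypotheses (N_gt0 : (0 < N)%N) (la_gt0 : 0 < la).
Local Notation row := {ffun 'I_(N + N) -> 'I_L.+1}.
Local Notation mat := {ffun 'I_m -> row}.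
Local Notation bal a := (balanced_at (fun j => nat_of_ord (a j))).
Local Notation weight a := (trunc_weight la a).
Implicit Types (sg tu : {set 'I_N}) (a : row) (M : mat).

Let mu : R := (N + N)%:R * la.

Let mu_gt0 : 0 < mu.
Proof. by rewrite mulr_gt0// ltr0n addn_gt0 N_gt0. Qed.

Lemma sum_prod_rows (f : row -> R) :
  \sum_(M : mat) (\prod_i weight (M i)) * \prod_i f (M i) = (\sum_a weight a * f a) ^+ m.
Proof.
rewrite -[in RHS](card_ord m) -prodr_const bigA_distr_bigA.
by apply: eq_bigr => M _; rewrite -big_split; apply: eq_bigr.
Qed.

Definition solvable_mat M : bool :=
  [exists sg : {set 'I_N}, [forall i, bal (M i) (spin sg)]] &&
  [exists i, odd (\sum_j M i j)%N].

Definition mean_ratio M : R :=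
  2^-1 ^+ N * \sum_sg \prod_i balance_ratio R sg (M i).

(* Chebyshev's inequality, pointwise: [mean_ratio M] vanishes when no balanced
   signing works. *)
Lemma solvable_mat_ge M :
  1 - (1 - mean_ratio M) ^+ 2 - \prod_i (~~ odd (\sum_j M i j)%N)%:R <=
    (solvable_mat M)%:R :> R.
Proof.
rewrite /solvable_mat; have q0 := sqr_ge0 (1 - mean_ratio M).
case: (boolP [exists i, _]) => [_|]; last first.
  rewrite negb_exists => /forallP ev; rewrite andbF.
  rewrite big1 => [|i _]; last by rewrite ev.
  by rewrite /=; lra.
have p0 : 0 <= \prod_i (~~ odd (\sum_j M i j)%N)%:R :> R by apply: prodr_ge0.
rewrite andbT; case: (boolP [exists sg, _]) => [_|]; first by rewrite /=; lra.
rewrite negb_exists => /forallP nsg.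
have -> : mean_ratio M = 0.
  rewrite /mean_ratio big1 ?mulr0// => sg _.
  have := nsg sg; rewrite negb_forall => /existsP[i /negbTE Mi].
  by rewrite (bigD1 i)//= /balance_ratio Mi !mul0r.
by rewrite /=; lra.
Qed.

Lemma second_moment_sum :
  \sum_(M : mat) (\prod_i weight (M i)) * mean_ratio M ^+ 2 =
  2^-1 ^+ N * 2^-1 ^+ N * \sum_(sg : {set 'I_N}) \sum_(tu : {set 'I_N}) balance_corr L la sg tu ^+ m.
Proof.
rewrite /balance_corr.
under [in RHS]eq_bigr do under eq_bigr do rewrite -sum_prod_rows.
under [in RHS]eq_bigr do rewrite exchange_big.
rewrite exchange_big /= mulr_sumr; apply: eq_bigr => M _.
rewrite /mean_ratio exprMn -expr2 mulrCA; congr (_ * _).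
rewrite expr2 mulr_suml mulr_sumr; apply: eq_bigr => sg _.
rewrite !mulr_sumr; apply: eq_bigr => tu _.
by rewrite -big_split; congr (_ * _); apply: eq_bigr.
Qed.

(** Since [1 - (1 - x) ^ 2 = 2 x - x ^ 2], summing [solvable_mat_ge] against the weights involves
    only the first two moments of [mean_ratio] and the all-even mass. *)
Lemma sum_solvable_ge :
  2 * trunc_mass N L la ^+ m
  - 2^-1 ^+ N * 2^-1 ^+ N * (\sum_(sg : {set 'I_N}) \sum_(tu : {set 'I_N}) balance_corr L la sg tu ^+ m)
  - (\sum_(s < L.+1) (~~ odd s)%:R * poisson_pmf mu s) ^+ m
  <= \sum_(M | solvable_mat M) \prod_i weight (M i).
Proof.
rewrite -second_moment_sum -sum_trunc_weight_even// -sum_prod_rows.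
have e2 : trunc_mass N L la ^+ m = \sum_(M : mat) (\prod_i weight (M i)) * mean_ratio M.
  under eq_bigr do rewrite /mean_ratio mulrCA mulr_sumr.
  rewrite -mulr_sumr exchange_big /=.
  under eq_bigr do rewrite sum_prod_rows sum_balance_ratio//.
  rewrite sumr_const -cardsT -powersetT card_powerset cardsT card_ord -[X in _ * X]mulr_natl.
  by rewrite natrX mulrA -exprMn mulVf ?expr1n ?mul1r.
rewrite e2 mulr_sumr -!sumrB [leRHS]big_mkcond /=.
apply: ler_sum => M _.
have W0 : 0 <= \prod_i weight (M i) by apply: prodr_ge0 => i _; exact: trunc_weight_ge0.
have := ler_wpM2l W0 (solvable_mat_ge M).
move: (\prod_i (~~ _)%:R) => ev; rewrite !mulrBr mulr1 => le.
rewrite (_ : _ - _ - _ = \prod_i weight (M i) - \prod_i weight (M i) * (1 - mean_ratio M) ^+ 2 -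
  \prod_i weight (M i) * ev); last by ring.
by apply: le_trans le _; case: (solvable_mat M); rewrite ?mulr1 ?mulr0.
Qed.

Lemma balance_corr_exp_le sg tu (S := N%:R - 2 * #|symdiff sg tu|%:R : R) :
  balance_corr L la sg tu ^+ m <=
    expR (2 * m%:R / N%:R ^+ 2 * S ^+ 2) +
    expR (- (N%:R / 32)) * (1 + mu) ^+ m * expR ((16 * N%:R)^-1 * S ^+ 2).
Proof.
have NR : 0 < N%:R :> R by rewrite ltr0n.
have c0 := balance_corr_ge0 L la sg tu.
have p0 : 0 <= (1 + mu) ^+ m by rewrite exprn_ge0// addr_ge0// ltW.
pose rho := S / N%:R.
(* Below 1/2, [1 / (1 - rho ^ 2) <= 1 + 2 rho ^ 2 <= exp (2 rho ^ 2)]. *)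
have [r2|r2] := lerP (rho ^+ 2) 2^-1.
  have rho1 : rho ^+ 2 < 1 by lra.
  have r0 := sqr_ge0 rho.
  apply: (@le_trans _ _ (expR (2 * m%:R / N%:R ^+ 2 * S ^+ 2))); last first.
    by rewrite lerDl mulr_ge0 ?expR_ge0 ?mulr_ge0 ?expR_ge0.
  have -> : 2 * m%:R / N%:R ^+ 2 * S ^+ 2 = m%:R * (2 * rho ^+ 2).
    by rewrite /rho; field; rewrite gt_eqF.
  rewrite expRM_natl lerXn2r ?nnegrE ?expR_ge0//.
  apply: le_trans (balance_corr_le L N_gt0 la_gt0 rho1) _.
  have d0 : 0 < 1 - rho ^+ 2 by rewrite subr_gt0.
  rewrite ler_pdivrMr//; apply: le_trans (sum_poisson_pmf_le1 mu_gt0 _) _.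
  apply: (@le_trans _ _ ((1 + 2 * rho ^+ 2) * (1 - rho ^+ 2))); first by nra.
  by rewrite ler_wpM2r ?(ltW d0) ?expR_ge1Dx.
(* Here [S ^ 2 > N ^ 2 / 2], so [S ^ 2 / (16 N)] exceeds [N / 32] and the two exponentials together
   are at least 1. *)
apply: (@le_trans _ _ ((1 + mu) ^+ m)).
  rewrite lerXn2r ?nnegrE ?addr_ge0 ?(ltW mu_gt0)//.
  exact: le_trans (balance_corr_le_mean L N_gt0 la_gt0 sg tu) (poisson_mean_le mu_gt0 _).
rewrite -[leLHS]add0r lerD ?expR_ge0// mulrAC -expRD ler_peMl//.
rewrite -[leLHS]expR0 ler_expR; move: r2; rewrite /rho expr_div_n ltr_pdivlMr ?exprn_gt0// => r2.
rewrite addrC subr_ge0 [leRHS]mulrC ler_pdivlMr ?mulr_gt0//.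
by rewrite (_ : N%:R / 32 * (16 * N%:R) = 2^-1 * N%:R ^+ 2) ?ltW//; field.
Qed.

(** Both exponentials are walk moments at time [N]. The condition [16 t N <= 1] is [32 m <= N] for
    [t = 2 m / N ^ 2] and an equality for [t = 1 / (16 N)]. *)
Lemma mean_balance_corr_le : (32 * m <= N)%N ->
  2^-1 ^+ N * 2^-1 ^+ N * (\sum_(sg : {set 'I_N}) \sum_(tu : {set 'I_N}) balance_corr L la sg tu ^+ m) <=
  expR (4 * m%:R / N%:R) + expR 1 * expR (- (N%:R / 32)) * (1 + mu) ^+ m.
Proof.
move=> mN; have NR : 0 < N%:R :> R by rewrite ltr0n.
have p0 : 0 <= (1 + mu) ^+ m by rewrite exprn_ge0// addr_ge0// ltW.
pose f (x : R) := expR (2 * m%:R / N%:R ^+ 2 * x ^+ 2).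
pose g (x : R) := expR ((16 * N%:R)^-1 * x ^+ 2).
pose c := expR (- (N%:R / 32)) * (1 + mu) ^+ m.
apply: (@le_trans _ _ (walk_mean N (fun x => f x + c * g x))).
  rewrite -mean_symdiff ler_wpM2l ?mulr_ge0 ?exprn_ge0 ?invr_ge0//.
  by apply: ler_sum => sg _; apply: ler_sum => tu _; exact: balance_corr_exp_le.
have -> : walk_mean N (fun x => f x + c * g x) = walk_mean N f + c * walk_mean N g.
  rewrite -walk_meanZ /walk_mean -mulrDr -big_split; congr (_ * _).
  by apply: eq_bigr => j _; rewrite mulrDr.
apply: lerD.
  apply: le_trans (walk_mean_expR_sqr _ _) _.
  - by rewrite divr_ge0 ?exprn_ge0// mulr_ge0.
  - have -> : 16 * (2 * m%:R / N%:R ^+ 2) * N%:R = (32 * m)%:R / N%:R :> R.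
      by rewrite natrM; field; rewrite gt_eqF.
    by rewrite ler_pdivrMr// mul1r ler_nat.
  - by rewrite ler_expR le_eqVlt; apply/orP; left; apply/eqP; field; rewrite gt_eqF.
rewrite -mulrA mulrC ler_wpM2r ?mulr_ge0 ?expR_ge0//.
apply: le_trans (walk_mean_expR_sqr _ _) _.
- by rewrite invr_ge0 mulr_ge0.
- have -> : 16 * (16 * N%:R)^-1 * N%:R = 1 :> R by field; rewrite gt_eqF.
  by [].
- have -> : 2 * (16 * N%:R)^-1 * N%:R = 8^-1 :> R by field; rewrite gt_eqF.
  by rewrite ler_expR; lra.
Qed.

End SecondMoment.

(** * Deterministic criterion for discrepancy one *)

Section Discrepancy.
Variables (R : realType) (m n : nat) (B : 'I_m -> 'I_n -> nat).
Let A : 'M[R]_(m, n) := \matrix_(i, j) (B i j)%:R.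

Lemma mulmx_signingE (u : {ffun 'I_n -> bool}) i k :
  (A *m signing R u) i k =
    (\sum_(j | ~~ u j) B i j)%N%:R - (\sum_(j | u j) B i j)%N%:R.
Proof.
rewrite !mxE (bigID u) /= addrC !natr_sum; congr (_ + _).
  by apply: eq_bigr => j /negbTE uj; rewrite !mxE uj expr0 mulr1.
by rewrite -sumrN; apply: eq_bigr => j uj; rewrite !mxE uj expr1 mulrN1.
Qed.

Lemma disc_le (u : {ffun 'I_n -> bool}) (x : R) : 0 <= x ->
  (forall i k, `|(A *m signing R u) i k| <= x) -> disc A <= x.
Proof.
move=> x0 le; apply: (@le_trans _ _ `|A *m signing R u|).
  by rewrite /disc (bigD1 u)//= ge_min lexx.
by rewrite {1}/Num.norm /= mx_normrE; apply: bigmax_le => // -[i k] _; exact: le.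
Qed.

Lemma le_disc (x : R) :
  (forall u : {ffun 'I_n -> bool}, exists i k, x <= `|(A *m signing R u) i k|) -> x <= disc A.
Proof.
move=> le; have leu u : x <= `|A *m signing R u|.
  have [i [k ik]] := le u; apply: le_trans ik _.
  by rewrite [leRHS]/Num.norm /= mx_normrE; apply/bigmax_geP; right; exists (i, k).
by rewrite /disc; apply: le_bigmin.
Qed.

Lemma disc_eq1 (u : pred 'I_n) : (forall i, balanced_at (B i) u) ->
  (exists i, odd (\sum_j B i j)%N) -> disc A = 1.
Proof.
move=> bal [i0 odd0]; apply/eqP; rewrite eq_le; apply/andP; split.
  apply: (@disc_le [ffun j => ~~ u j]) => // i k; rewrite mulmx_signingE.
  under eq_bigl do rewrite ffunE negbK.
  under [X in _ - X%:R]eq_bigl do rewrite ffunE.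
  have /andP[] := balanced_at_le1 (bal i).
  move: (\sum_(j | u j) _)%N (\sum_(j | ~~ u j) _)%N => x y xy yx.
  rewrite -(ler_nat R) -natr1 in xy; rewrite -(ler_nat R) -natr1 in yx.
  by rewrite ler_norml; apply/andP; split; lra.
(* The two weights of row [i0] have odd total, so they are distinct integers. *)
apply: le_disc => u'; exists i0, 0; rewrite mulmx_signingE.
move: odd0; rewrite (bigID u') /=.
move: (\sum_(j | u' j) _)%N (\sum_(j | ~~ u' j) _)%N => x y xy.
have [lt|lt|e] := ltngtP x y.
- rewrite ger0_norm ?subr_ge0 ?ler_nat 1?ltnW// lerBrDr nat1r ler_nat//.
- rewrite distrC ger0_norm ?subr_ge0 ?ler_nat 1?ltnW// lerBrDr nat1r ler_nat//.
- by move: xy; rewrite e addnn odd_double.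
Qed.

End Discrepancy.

(** * Events of the ensemble and their probabilities *)

Section PoissonEnsemble.
Variables (R : realType) (d : measure_display) (T : measurableType d).
Variables (P : probability T R) (m n : nat) (A : 'I_m -> 'I_n -> {RV P >-> nat}).

Definition entries_at (M : 'I_m -> 'I_n -> nat) : set T :=
  \bigcap_(ij in [set` [set: 'I_m * 'I_n]%SET])
    (A ij.1 ij.2 @^-1` [set M ij.1 ij.2]).

Lemma entries_atP M w : entries_at M w <-> forall i j, A i j w = M i j.
Proof.
split=> [h i j|h [i j] _]; last exact: h.
by apply: (h (i, j)); rewrite /= finset.in_setT.
Qed.

Lemma measurable_entries_at M : measurable (entries_at M).
Proof.
apply: fin_bigcap_measurable => //.
move=> ij _; rewrite -[X in measurable X]setTI.
by apply: measurable_funP.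
Qed.

(** There are countably many integer matrices, so any such event is a countable union of the cells
    [entries_at M]. *)
Lemma measurable_entries (Q : ('I_m -> 'I_n -> nat) -> Prop) :
  measurable [set w | Q (fun i j => A i j w)].
Proof.
rewrite (_ : [set w | _] = \bigcup_(M : {ffun 'I_m * 'I_n -> nat})
   (if `[<Q (fun i j => M (i, j))>] then entries_at (fun i j => M (i, j)) else set0)).
  apply: countable_bigcupT_measurable => // M.
  by case: ifP => // _; exact: measurable_entries_at.
apply/seteqP; split=> w /=.
  move=> Qw; exists [ffun ij => A ij.1 ij.2 w] => //.
  have e : (fun i j => [ffun ij => A ij.1 ij.2 w] (i, j)) = (fun i j => A i j w).
    by apply/funext => i; apply/funext => j; rewrite ffunE.
  by rewrite e asboolT//; apply/entries_atP.
move=> [M _]; case: asboolP => // QM /entries_atP e.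
suff -> : (fun i j => A i j w) = (fun i j => M (i, j)) by [].
by apply/funext => i; apply/funext => j.
Qed.

Variables (la : R).
Hypotheses (la_gt0 : 0 < la) (ensA : poisson_ensemble A la).

Lemma prob_entries_at M :
  P (entries_at M) = (\prod_i \prod_j poisson_pmf la (M i j))%:E.
Proof.
have [indep law] := ensA.
rewrite /entries_at (indep [set: 'I_m * 'I_n]%SET (fun ij => [set M ij.1 ij.2]))//.
rewrite pair_big -prodEFin /=; apply: eq_big => [ij|ij _]; first by rewrite finset.in_setT.
have := law ij.1 ij.2 [set M ij.1 ij.2].
rewrite /distribution /pushforward => ->.
by rewrite /poisson_prob la_gt0 esum_set1// lee_fin poisson_pmf_ge0.
Qed.

(** Transfers a finite sum to [P]: distinct matrices give disjoint cells. *)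
Lemma prob_entries_ge L (q : pred {ffun 'I_m -> {ffun 'I_n -> 'I_L.+1}})
    (Q : ('I_m -> 'I_n -> nat) -> Prop) :
  (forall M, q M -> Q (fun i j => M i j)) ->
  ((\sum_(M | q M) \prod_i \prod_j poisson_pmf la (M i j))%:E <=
    P [set w | Q (fun i j => A i j w)])%E.
Proof.
move=> qQ.
pose E (M : {ffun 'I_m -> {ffun 'I_n -> 'I_L.+1}}) := entries_at (fun i j => M i j).
have mE M : measurable (E M) by exact: measurable_entries_at.
have -> : (\sum_(M | q M) \prod_i \prod_j poisson_pmf la (M i j))%:E =
    P (\bigcup_(M in [set` q]) E M).
  rewrite measure_fin_bigcup//; last first.
    apply/trivIsetP => M M' _ _ MM'; rewrite -subset0 => w [/entries_atP e /entries_atP e'].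
    move/eqP: MM'; apply; apply/ffunP => i; apply/ffunP => j; apply: val_inj => /=.
    by rewrite -e -e'.
  rewrite -(@bigfs _ _ _ _ (index_enum _) q) ?index_enum_uniq//; last by move=> M _; rewrite mem_index_enum.
  by rewrite -sumEFin; apply: eq_bigr => M _; exact/esym/prob_entries_at.
apply: le_measure; rewrite ?inE.
- by apply: fin_bigcup_measurable.
- exact: measurable_entries.
- move=> w [M qM /entries_atP e] /=.
  have -> : (fun i j => A i j w) = (fun i j => M i j : nat).
    by apply/funext => i; apply/funext => j.
  exact: qQ.
Qed.

End PoissonEnsemble.

(** * Lower bound on the probability of discrepancy one *)

Section DiscrepancyProbability.
Variables (R : realType) (d : measure_display) (T : measurableType d).
Variables (P : probability T R).

Lemma measurable_disc_eq1 m n (A : 'I_m -> 'I_n -> {RV P >-> nat}) :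
  measurable [set w | disc (sample A w) = 1].
Proof.
exact: (@measurable_entries _ _ _ _ _ _ A
  (fun B => disc (\matrix_(i, j) (B i j)%:R : 'M[R]_(m, n)) = 1)).
Qed.

Lemma prob_disc_ge m n N (A : 'I_m -> 'I_n -> {RV P >-> nat}) (la : R)
    (mu : R := n%:R * la) :
  n = (N + N)%N -> (0 < N)%N -> (32 * m <= N)%N -> 0 < la -> poisson_ensemble A la ->
  ((2 - expR (4 * m%:R / N%:R) - expR 1 * expR (- (N%:R / 32)) * (1 + mu) ^+ m
    - ((1 + expR (- (2 * mu))) / 2) ^+ m)%:E <=
   P [set w | disc (sample A w) = 1%R])%E.
Proof.
move=> nN; subst n => N0 mN la0 ens.
have mu0 : 0 < mu by rewrite mulr_gt0// ltr0n addn_gt0 N0.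
set S := [set w | _].
have mS : measurable S by exact: measurable_disc_eq1.
have fS : P S \is a fin_num by exact: fin_num_measure.
rewrite -(fineK fS) lee_fin.
set c := (- expR (4 * m%:R / N%:R) - expR 1 * expR (- (N%:R / 32)) * (1 + mu) ^+ m
    - ((1 + expR (- (2 * mu))) / 2) ^+ m).
rewrite (_ : 2 - _ - _ - _ = 2 * 1 ^+ m + c); last by rewrite /c expr1n; ring.
(* Only the first moment in the lower bound depends on [L]; it tends to 1. *)
pose f L := 2 * (\sum_(s < L.+1) poisson_pmf mu s) ^+ m + c.
have cf : f @ \oo --> 2 * 1 ^+ m + c.
  apply: cvgD; last exact: cvg_cst.
  apply: cvgMl_tmp; apply: (@continuous_cvg _ _ _ _ _ _ (fun x : R => x ^+ m) 1).
    exact: exprn_continuous.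
  by have := cvg_sum_poisson_pmf mu0; rewrite -(cvg_shiftS (fun n => \sum_(s < n) _)).
apply: (cvgr_to_le cf).
apply: nearW => L.
rewrite -lee_fin fineK//; pose q := @solvable_mat N m L.
apply: le_trans (@prob_entries_ge _ _ _ _ _ _ A la la0 ens L q
  (fun B => disc (\matrix_(i, j) (B i j)%:R : 'M[R]_(m, N + N)) = 1) _); last first.
  move=> M /andP[/existsP[sg /forallP bal] /existsP oddM].
  by apply: (disc_eq1 _ bal).
rewrite lee_fin.
have le1 := sum_solvable_ge m L N0 la0.
have le2 := mean_balance_corr_le L N0 la0 mN.
have le3 : (\sum_(s < L.+1) (~~ odd s)%:R * poisson_pmf mu s) ^+ m <=
    ((1 + expR (- (2 * mu))) / 2) ^+ m.
  apply: lerXn2r; rewrite ?nnegrE.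
  - by apply: sumr_ge0 => s _; rewrite mulr_ge0// poisson_pmf_ge0.
  - by rewrite divr_ge0// addr_ge0// expR_ge0.
  - exact: sum_even_poisson_pmf_le.
have le4 : \sum_(M | q M) \prod_i trunc_weight la (M i) <=
    \sum_(M | q M) \prod_i \prod_j poisson_pmf la (M i j).
  apply: ler_sum => M _; apply: ler_prod => i _; rewrite trunc_weight_ge0 /=.
  rewrite /trunc_weight; case: (_ <= L)%N; rewrite ?mul1r// mul0r prodr_ge0// => j _.
  exact: poisson_pmf_ge0.
rewrite /trunc_mass -/mu in le1; rewrite -/mu in le2; clearbody mu.
by apply: le_trans le4; apply: le_trans le1; rewrite /f /c; lra.
Qed.

End DiscrepancyProbability.

(** * Elementary estimates for the limit in [m] *)

Section Asymptotics.
Variable R : realType.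

Lemma poly_le_expR (p : {poly R}) : exists2 b : R, 0 <= b &
  forall x y : R, 1 <= x -> y <= p.[x] ->
    1 + x * y <= expR (b + (size p).+1%:R * ln x).
Proof.
pose B := \sum_(i < size p) `|p`_i|.
have B0 : 0 <= B by apply: sumr_ge0.
(* Chosen so that the right side is [(1 + B) * x ^ (size p + 1)]. *)
exists (ln (1 + B)); first by rewrite ln_ge0// lerDl.
move=> x y x1 yp; have x0 : 0 < x by apply: lt_le_trans x1.
rewrite expRD expRM_natl !lnK ?posrE ?ltr_wpDr//.
have pB : p.[x] <= B * x ^+ size p.
  rewrite horner_coef /B mulr_suml; apply: ler_sum => i _.
  apply: (@le_trans _ _ (`|p`_i| * x ^+ i)).
    by apply: ler_wpM2r; [exact/exprn_ge0/ltW | exact: ler_norm].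
  by apply: ler_wpM2l => //; apply: ler_weXn2l => //; rewrite ltnW.
have xn : 1 <= x ^+ (size p).+1 by rewrite exprn_ege1.
have : x * y <= B * x ^+ (size p).+1.
  rewrite exprS mulrCA; apply: ler_wpM2l; first exact: ltW.
  exact: le_trans pB.
by rewrite mulrDl mul1r; lra.
Qed.

(* With [x = n / M], this is [ln n = ln x + ln M] with [ln x <= ln a + x / a] for
   [a = 512 E], and [ln M < x / a]. *)
Lemma mul_ln_le (E b M n : R) : 1 <= E -> 0 < M -> 0 < n ->
  512 * E * M * ln M < n -> 256 * (b + E * ln (512 * E)) <= n / M ->
  M * (b + E * ln n) <= n / 128.
Proof.
move=> E1 M0 n0 nM; rewrite ler_pdivlMr// => hb.
have a0 : 0 < 512 * E by lra.
have h : ln n <= ln (512 * E) + n / M / (512 * E) + ln M.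
  have x0 : 0 < n / M / (512 * E) by rewrite !divr_gt0.
  have -> : ln n = ln (n / M / (512 * E)) + ln (512 * E) + ln M.
    have xa := mulr_gt0 x0 a0.
    rewrite -lnM ?posrE// -lnM ?posrE//; congr ln.
    by field; rewrite !gt_eqF//; lra.
  have := ln_sublinear x0; lra.
have h2 : M * (E * (n / M / (512 * E))) = n / 512 by field; rewrite !gt_eqF//; lra.
have : M * E * ln n <= M * E * (ln (512 * E) + n / M / (512 * E) + ln M).
  by rewrite ler_wpM2l// mulr_ge0//; lra.
have -> : M * E * (ln (512 * E) + n / M / (512 * E) + ln M) =
  M * E * ln (512 * E) + n / 512 + E * M * ln M by rewrite -h2; ring.
move: (ln n) (ln M) (ln (512 * E)) nM hb {h} => u v w nM hb h.
by lra.
Qed.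

(** From [exp (- 2 mu) <= 1 / (1 + 2 mu)], the base is at most [1 - mu / (1 + 2 mu) <= 1 - min (mu,
    1) / 3]. *)
Lemma exp_half_le (mu : R) m : 0 < mu ->
  ((1 + expR (- (2 * mu))) / 2) ^+ m <= expR (- (Num.min (m%:R * mu) m%:R / 3)).
Proof.
move=> mu0.
have e0 := expR_gt0 (- (2 * mu)).
have h1 : (1 + expR (- (2 * mu))) / 2 <= expR (- (Num.min mu 1 / 3)).
  apply: le_trans (expR_ge1Dx _).
  have h : expR (- (2 * mu)) * (1 + 2 * mu) <= 1.
    rewrite -[leRHS](expRxMexpNx_1 (- (2 * mu))) opprK ler_pM2l//.
    exact: expR_ge1Dx.
  have [l|l] := leP mu 1; nra.
have p0 : 0 <= (1 + expR (- (2 * mu))) / 2 by lra.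
have h2 : ((1 + expR (- (2 * mu))) / 2) ^+ m <= expR (- (Num.min mu 1 / 3)) ^+ m.
  by apply: lerXn2r; rewrite ?nnegrE ?expR_ge0.
apply: le_trans h2 _.
rewrite -expRM_natl ler_expR mulrN lerN2 mulrA ler_wpM2r//.
by rewrite -{2}[m%:R]mulr1 -minr_pMr.
Qed.

Lemma near_ln_ge (A : R) : \forall m \near \oo, A <= ln (m%:R : R).
Proof.
have := @cvgr_idn R => /cvgryPge /(_ (expR A)).
apply: filterS => m h; rewrite -[A]expRK ler_ln ?posrE ?expR_gt0//.
by apply: lt_le_trans h; exact: expR_gt0.
Qed.

End Asymptotics.

(** The constant depends on [p] only through its size. The divergence of [m n lambda] excludes the
    zero matrix, which has probability [exp (- m n lambda)] and discrepancy 0. *)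
Theorem corollary1p1 (R : realType) (p : {poly R}) :
  exists2 C : R, 0 < C &
    forall (n : nat -> nat) (lambda : nat -> R)
      (d : measure_display) (T : nat -> measurableType d)
      (P : forall m, probability (T m) R)
      (A : forall m, 'I_m -> 'I_(n m) -> {RV P m >-> nat}),
      (\forall m \near \oo,
         [/\ poisson_ensemble (A m) (lambda m),
             ~~ odd (n m),
             0 < lambda m <= p.[(n m)%:R]
           & (n m)%:R > C * m%:R * ln (m%:R : R)]) ->
      (fun m => m%:R * (n m)%:R * lambda m) @ \oo --> +oo ->
      (fun m => P m [set w | disc (sample (A m) w) = 1]) @ \oo --> 1%E.
Proof.
have [b b0 pb] := poly_le_expR p.
set E : R := (size p).+1%:R.
have E1 : 1 <= E by rewrite ler1n.
exists (512 * E); first by lra.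
move=> n la d T P A hyp mnla.
(* Threshold for [ln m]: the second argument serves the last hypothesis of [mul_ln_le]. *)
pose K := Num.max 1 (b + E * ln (512 * E)).
pose x m : R := Num.min (m%:R * (n m)%:R * la m) m%:R / 3.
(* The terms of [prob_disc_ge] are replaced by simpler ones with limits 1, 0 and 0. *)
pose l m : R := 2 - expR ((ln m%:R)^-1) - expR 1 * expR (- ln m%:R) - expR (- x m).
have cvg_ln : (fun m => ln m%:R : R) @ \oo --> +oo.
  by apply/cvgryPge => B; exact: near_ln_ge.
have cvg_x : x @ \oo --> +oo.
  apply/cvgryPge => B; move/cvgryPge : mnla => /(_ (3 * B)).
  have := @cvgr_idn R => /cvgryPge /(_ (3 * B)).
  apply: filterS2 => m h1 h2; rewrite /x ler_pdivlMr// mulrC.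
  by rewrite le_min h1 h2.
have cvg_expN (f : nat -> R) : f @ \oo --> +oo -> (fun m => expR (- f m)) @ \oo --> 0.
  by move=> cf; exact: (cvg_comp f (fun y => expR (- y)) cf (@cvgr_expR R)).
have cvg_l : l @ \oo --> (1 : R).
  rewrite (_ : 1 = 2 - 1 - expR 1 * 0 - 0 :> R); last by ring.
  apply: cvgB; last exact: cvg_expN.
  apply: cvgB; last by apply: cvgMl_tmp; exact: cvg_expN.
  apply: cvgB; first exact: cvg_cst.
  have cvg_iln : (fun m => (ln (m%:R : R))^-1) @ \oo --> (0 : R).
    apply: (proj2 (gtr0_cvgV0 _) cvg_ln).
    by have := near_ln_ge (1 : R); apply: filterS => m h; apply: lt_le_trans h.
  have := cvg_comp _ _ cvg_iln (@continuous_expR R 0); rewrite expR0; exact.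
apply: (@squeeze_cvge _ _ _ _ (fun m => (l m)%:E) _ (fun=> 1%E)).
- near=> m; apply/andP; split; last exact/probability_le1/measurable_disc_eq1.
  have [ens ev /andP[la0 lap] nC] :
      [/\ poisson_ensemble (A m) (la m), ~~ odd (n m), 0 < la m <= p.[(n m)%:R]
         & (n m)%:R > 512 * E * m%:R * ln (m%:R : R)] by near: m.
  have Kln : K <= ln m%:R by near: m; exact: near_ln_ge.
  move: Kln; rewrite /K ge_max => /andP[ln1 lnK].
  have m0 : 0 < m%:R :> R.
    (* [ln] is 0 at 0 by convention, so [1 <= ln m] rules out [m = 0]. *)
    rewrite ltr0n lt0n; apply: contraTneq ln1 => ->.
    by rewrite ln0// -ltNge.
  pose N := (n m)./2.
  have nN : n m = (N + N)%N by rewrite addnn even_halfK.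
  have nNR : (n m)%:R = 2 * N%:R :> R by rewrite nN natrD; ring.
  have mln : m%:R <= m%:R * ln m%:R :> R by rewrite ler_peMr// ltW.
  have nm : 512 * m%:R * ln m%:R < (n m)%:R :> R.
    apply: le_lt_trans nC; rewrite -!mulrA ler_pM2l//.
    by rewrite ler_peMl// mulr_ge0 ?ltW//; lra.
  have n0 : 0 < (n m)%:R :> R by lra.
  have N0 : (0 < N)%N by rewrite -(ltr0n R); lra.
  have NR : 0 < N%:R :> R by rewrite ltr0n.
  have mN : (32 * m <= N)%N by rewrite -(ler_nat R) natrM; lra.
  apply: le_trans (prob_disc_ge nN N0 mN la0 ens).
  rewrite lee_fin /l; set mu := (n m)%:R * la m.
  have mu0 : 0 < mu by rewrite mulr_gt0.
  have h1 : expR (4 * m%:R / N%:R) <= expR ((ln m%:R)^-1) :> R.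
    rewrite ler_expR ler_pdivrMr// [leRHS]mulrC ler_pdivlMr; last by lra.
    by lra.
  have h3 : ((1 + expR (- (2 * mu))) / 2) ^+ m <= expR (- x m).
    by rewrite /x -mulrA; exact: exp_half_le.
  have h2 : expR (- (N%:R / 32)) * (1 + mu) ^+ m <= expR (- ln m%:R).
    have q : 1 + mu <= expR (b + E * ln (n m)%:R).
      apply: pb => //; rewrite ler1n -(ltr0n R); lra.
    have q2 : (1 + mu) ^+ m <= expR (m%:R * (b + E * ln (n m)%:R)).
      by rewrite expRM_natl lerXn2r ?nnegrE ?expR_ge0// addr_ge0// ltW.
    apply: (@le_trans _ _ (expR (- (N%:R / 32)) * expR (m%:R * (b + E * ln (n m)%:R)))).
      by rewrite ler_wpM2l ?expR_ge0.
    rewrite -expRD ler_expR.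
    (* Half of the exponent [N / 32 = n / 64] pays for [(1 + mu) ^ m]; the other half exceeds
       [ln m]. *)
    have q3 : m%:R * (b + E * ln (n m)%:R) <= (n m)%:R / 128.
      apply: mul_ln_le => //; rewrite ler_pdivlMr//.
      apply: le_trans (ltW nm); apply: (@le_trans _ _ (256 * ln m%:R * m%:R)).
        by apply: ler_wpM2r; [exact: ltW | rewrite ler_pM2l].
      by nra.
    have : ln m%:R <= m%:R * ln m%:R :> R.
      by rewrite ler_peMl//; [lra|rewrite ler1n -(ltr0n R)].
    by lra.
  have e0 := expR_gt0 (1 : R).
  have := ler_wpM2l (ltW e0) h2; rewrite mulrA; lra.
- by apply/fine_cvgP; split => //; exact: nearW.
- exact: cvg_cst.
Unshelve. all: by end_near.
Qed.
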